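(* Let $A\in\mathbb F^{n\times n}$ be an invertible matrix with $A^H=A$, associated with graph $G$. If $G$ has treewidth $\tau\ge1$, then $A^{-1}$ admits a butterfly factorization of rank $O(\tau)$.
   Context: $\mathbb F$ is an arbitrary field with a fixed involution $a\mapsto a^*$ (a field automorphism with $(a^* )^*=a$, possibly the identity); $(X^H)_{ij}=x_{ji}^*$. The graph $G$ associated with $A$ has vertex set $\{1,\dots,n\}$ and an edge $\{i,j\}$, $i\neq j$, whenever $a_{ij}\ne0$. Treewidth is the minimum over tree decompositions of the maximum bag size minus one. Strict complementary rank: a matrix $K\in\mathbb F^{n\times n}$ with $K^H=K$ has strict complementary rank $r$ if there exists a one-to-one mapping between the row/column indices $\{1,\dots,n\}$ and the nodes of a (rooted) binary tree, such that for any node $u$ of the tree, with $S$ the set of indices mapped to the subtree rooted at $u$ and $V$ the remaining indices, $\operatorname{rank}(K_{S,V})\le r$, where $K_{S,V}$ is the submatrix of $K$ with rows $S$ and columns $V$. Butterfly decomposition (factorization): given $K$ with $K^H=K$ of strict complementary rank $r$, a butterfly decomposition of $K$ of rank $r$ is $K=B_1\cdots B_k$, where $k=O(\log n)$ and each $B_i$ consists of a diagonal part and at most $\lceil n/r\rceil$ nonzero blocks of size $r\times r$. The position of the nonzero blocks in each $B_i$ is not restricted; rows and columns of $K$ may be taken in an appropriate ordering (equivalently, a block is a submatrix given by a choice of $r$ rows and $r$ columns). The constants in $O(\cdot)$ are absolute. *)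

(* Defs.v *)
From mathcomp Require Import all_boot all_order all_algebra.

Set Implicit Arguments.
Unset Strict Implicit.
Unset Printing Implicit Defensive.

Import GRing.Theory.
Local Open Scope ring_scope.

(* X^H, for the involution [inv] of the field. *)
Definition conjtrmx (F : fieldType) (inv : F -> F) (m n : nat)
    (X : 'M[F]_(m, n)) : 'M[F]_(n, m) :=
  \matrix_(i, j) inv (X j i).

Definition mx_graph (F : fieldType) (n : nat) (A : 'M[F]_n) : rel 'I_n :=
  fun i j => (i != j) && (A i j != 0).

(* In [acyclic], a sequence [c] with [ucycle e c] is a cyclic walk without
   repeated vertices; those of size 2 merely traverse one edge back and forth. *)
Definition acyclic (T : finType) (e : rel T) : Prop :=
  forall c : seq T, ucycle e c -> (size c <= 2)%N.

Definition is_tree (T : finType) (e : rel T) : Prop :=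
  [/\ (0 < #|T|)%N, symmetric e, irreflexive e,
      forall x y : T, connect e x y & acyclic e].

Record is_tree_decomposition (V : finType) (g : rel V)
    (T : finType) (e : rel T) (bag : T -> {set V}) : Prop := {
  td_tree : is_tree e;
  td_vertex : forall v : V, exists t : T, v \in bag t;
  td_edge : forall u v : V, g u v ->
    exists t : T, u \in bag t /\ v \in bag t;
  td_connected : forall (v : V) (s t : T), v \in bag s -> v \in bag t ->
    connect [rel x y | [&& e x y, v \in bag x & v \in bag y]] s t
}.

(* The predecessor is truncated: a graph without vertices gets width 0. *)
Definition td_width (V T : finType) (bag : T -> {set V}) : nat :=
  (\max_(t : T) #|bag t|).-1.

Definition has_treewidth (V : finType) (g : rel V) (tau : nat) : Prop :=
  (exists (T : finType) (e : rel T) (bag : T -> {set V}),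
      is_tree_decomposition g e bag /\ td_width bag = tau) /\
  (forall (T : finType) (e : rel T) (bag : T -> {set V}),
      is_tree_decomposition g e bag -> (tau <= td_width bag)%N).

(* A rooted binary tree with labelled nodes; [BEmpty] is the absence of a
   child, so a node has zero, one or two children. *)
Inductive btree (T : Type) : Type :=
| BEmpty
| BNode of T & btree T & btree T.
Arguments BEmpty {T}.

Fixpoint labels (T : Type) (t : btree T) : seq T :=
  if t is BNode x l r then x :: labels l ++ labels r else [::].

(* For every node u, the labels of the subtree rooted at u. *)
Fixpoint subtree_labels (T : Type) (t : btree T) : seq (seq T) :=
  if t is BNode x l r
  then labels t :: subtree_labels l ++ subtree_labels r else [::].

Definition submx_of (F : fieldType) (n : nat) (K : 'M[F]_n)
    (S V : {set 'I_n}) : 'M[F]_(#|S|, #|V|) :=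
  \matrix_(i, j) K (enum_val i) (enum_val j).

(* A one-to-one mapping between indices and nodes is a labelling of the nodes
   in which every index occurs exactly once. *)
Definition strict_complementary_rank (F : fieldType) (n : nat)
    (K : 'M[F]_n) (r : nat) : Prop :=
  exists t : btree 'I_n,
    perm_eq (labels t) (enum 'I_n) /\
    forall s : seq 'I_n, s \in subtree_labels t ->
      (\rank (submx_of K [set i in s] (~: [set i in s])) <= r)%N.

Definition ceil_div (n r : nat) : nat := (n %/ r + ~~ (r %| n))%N.

(* A block position is a pair (rows, columns) of r-element index sets. *)
Definition butterfly_factor (F : fieldType) (n r : nat) (B : 'M[F]_n) : Prop :=
  exists blocks : seq ({set 'I_n} * {set 'I_n}),
    [/\ (size blocks <= ceil_div n r)%N,
        forall b, b \in blocks -> #|b.1| = r /\ #|b.2| = r &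
        forall i j : 'I_n, B i j != 0 ->
          i = j \/ exists2 b, b \in blocks & (i \in b.1) && (j \in b.2)].

(* [c] is the constant hidden in the O(log n) bound on the number of factors;
   [trunc_log 2 n] is the integer part of the base-2 logarithm of n. *)
Definition butterfly_decomposition (c : nat) (F : fieldType) (inv : F -> F)
    (n : nat) (K : 'M[F]_n) (r : nat) (Bs : seq 'M[F]_n) : Prop :=
  [/\ [/\ (0 < r)%N, conjtrmx inv K = K & strict_complementary_rank K r],
      (size Bs <= c * trunc_log 2 n)%N,
      forall B, B \in Bs -> butterfly_factor r B &
      K = \big[mulmx/1%:M]_(B <- Bs) B].

(* Main.v *)
(** Nested dissection with delayed pivots.  A tree decomposition of width [tau]
    yields, by alternately balancing the boundary and the size of a vertex set,
    a binary dissection tree of logarithmic depth in which separators and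
    boundaries have size O(tau) and every node covers more than [tau] vertices.
    Eliminating [A] along this tree, pivots that are not available over a
    general field (zero or singular diagonal blocks) are passed on to the
    parent; since [A] is invertible, at most as many pivots are delayed at a
    node as its boundary has vertices, so that all fronts have size O(tau).
    The row and column operations of a level act on disjoint fronts and form
    O(1) butterfly factors each.  At the root nothing is delayed, hence
    [P A Q^T = 1], and [A^-1 = Q^T P] is the desired factorization.

    For the strict complementary rank, the off-diagonal blocks of [A^-1] and of
    [A] at complementary index sets have the same rank, which for [A] is at most
    the number of boundary vertices. *)

Require Import Defs.
From mathcomp Require Import all_boot all_order all_algebra.
From mathcomp Require Import zify ring.

Set Implicit Arguments.
Unset Strict Implicit.
Unset Printing Implicit Defensive.

Import GRing.Theory.

(** * Leaves of acyclic graphs *)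

Section Forest.
Variables (T : finType) (e : rel T).
Hypotheses (e_sym : symmetric e) (e_acyclic : acyclic e).

(** The head of a longest simple path in [U] is a leaf: by maximality its other neighbours in [U]
    lie on the path, and any but the next vertex of the path would close a cycle. *)
Lemma acyclic_leaf (U : {set T}) :
  U != set0 -> exists2 t, t \in U & forall p q,
    p \in U -> q \in U -> e t p -> e t q -> p != t -> q != t -> p = q.
Proof.
case/set0Pn=> t0 t0U.
pose P k := [exists s : k.+1.-tuple T,
  [&& sorted e s, uniq s & all (mem U) s]].
have exP : exists k, P k.
  by exists 0; apply/existsP; exists [tuple t0]; rewrite /= t0U.
have leP k : P k -> k <= #|T|.
  case/existsP=> s /and3P[_ us _].
  by apply: ltnW; rewrite -(size_tuple s) -(card_uniqP us) max_card.
case: (ex_maxnP exP leP) => k /existsP[[[//|x s] /= sz]].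
case/and3P=> pxs /andP[xs us] /andP[xU sU] maxk.
exists x => //.
have in_s p : p \in U -> e x p -> p != x -> p \in s.
  move=> pU exp px; apply: contraT => ps.
  suff /maxk: P k.+1 by rewrite ltnn.
  have sz2 : size [:: p, x & s] == k.+2 by rewrite /= -(eqP sz).
  apply/existsP; exists (Tuple sz2) => /=.
  by rewrite e_sym exp pxs inE (negPf px) (negPf ps) xs us xU sU pU.
have first p : p \in U -> e x p -> p != x -> index p s = 0.
  move=> pU exp px; have ps := in_s p pU exp px.
  have /e_acyclic : ucycle e (x :: take (index p s).+1 s).
    rewrite /ucycle /= (take_uniq _ us) andbT; apply/andP; split; last first.
      by apply: contra xs => /mem_take.
    rewrite rcons_path take_path // /= (take_nth x) ?index_mem //.
    by rewrite last_rcons nth_index // e_sym.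
  by rewrite /= size_take_min (minn_idPl _) ?index_mem // => ?; apply/eqP; rewrite -leqn0.
move=> p q pU qU xp xq px qx.
rewrite -(nth_index x (in_s p pU xp px)) -(nth_index x (in_s q qU xq qx)).
by rewrite !first.
Qed.

End Forest.

(** * Closed neighbourhoods and outer vertex boundaries *)

Section Neighbourhoods.
Variables (V : finType) (g : rel V).

Definition nbhd (I : {set V}) := I :|: [set j | [exists i in I, g i j]].
Definition bdry (I : {set V}) := nbhd I :\: I.

Lemma sub_nbhd (I : {set V}) : I \subset nbhd I.
Proof. exact: subsetUl. Qed.

Lemma nbhdP (I : {set V}) j :
  reflect (j \in I \/ exists2 i, i \in I & g i j) (j \in nbhd I).
Proof.
rewrite !inE; apply: (iffP orP) => [] [jI|]; try by left.
  by case/exists_inP=> i iI gij; right; exists i.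
by case=> i iI gij; right; apply/exists_inP; exists i.
Qed.

Lemma nbhd_edge (I : {set V}) i j : i \in I -> g i j -> j \in nbhd I.
Proof. by move=> iI gij; apply/nbhdP; right; exists i. Qed.

Lemma nbhdS (I J : {set V}) : I \subset J -> nbhd I \subset nbhd J.
Proof.
move=> /subsetP sIJ; apply/subsetP=> j /nbhdP[/sIJ jJ|[i /sIJ iJ gij]].
  exact: (subsetP (sub_nbhd J)).
exact: nbhd_edge gij.
Qed.

Lemma nbhd0 : nbhd set0 = set0.
Proof.
apply/setP=> j; rewrite in_set0; apply/negbTE/nbhdP => -[|[i]]; by rewrite in_set0.
Qed.

Lemma bdry0 : bdry set0 = set0.
Proof. by rewrite /bdry nbhd0 setD0. Qed.

Lemma card_bdry_sub (S I : {set V}) :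
  S \subset I -> #|bdry S| <= #|bdry I| + #|I :\: S|.
Proof.
move=> sSI; apply: leq_trans (leq_card_setU _ _).
apply/subset_leq_card/subsetP=> j; rewrite in_setU !in_setD => /andP[-> jn].
by rewrite (subsetP (nbhdS sSI) j jn) andbT orNb.
Qed.

Hypothesis g_sym : symmetric g.

Lemma disjoint_nbhd (I J : {set V}) : [disjoint nbhd I & J] -> [disjoint I & nbhd J].
Proof.
move=> dIJ; rewrite -setI_eq0; apply/eqP/setP=> j; rewrite in_setI in_set0.
apply/negbTE/andP=> -[jI] /nbhdP[jJ|[i iJ gij]].
  by case/pred0Pn: dIJ; exists j => /=; rewrite jJ (subsetP (sub_nbhd I)).
case/pred0Pn: dIJ; exists i => /=; rewrite iJ andbT.
by apply: (nbhd_edge jI); rewrite g_sym.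
Qed.

End Neighbourhoods.

(** * Balanced separators from a tree decomposition *)

Section Separator.
Variables (V : finType) (g : rel V) (T : finType) (e : rel T).
Variables (bag : T -> {set V}) (w : nat).
Hypotheses (g_sym : symmetric g) (tdec : is_tree_decomposition g e bag).
Hypothesis bag_w : forall t, #|bag t| <= w.
Variable W : {set V}.

(* The state reached after contracting leaves of the tree: [U] is what remains
   of the tree, and [acc t] collects the vertices that have been absorbed into
   node [t] and occur in no remaining bag.  Connectedness of the nodes
   containing [v] is expressed by cuts, a form that survives the removal of a
   leaf. *)
Record contracted (U : {set T}) (acc : T -> {set V}) : Prop := Contracted {
  ctr_cover : forall v, exists2 t, t \in U & v \in bag t :|: acc t;
  ctr_acc_bag : forall s t v, s \in U -> t \in U -> v \in acc s -> v \notin bag t;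
  ctr_nbhd : forall t, t \in U -> nbhd g (acc t) \subset acc t :|: bag t;
  ctr_edge : forall u v, g u v ->
    exists2 t, t \in U & [|| (u \in bag t) && (v \in bag t), u \in acc t | v \in acc t];
  ctr_cut : forall v (Q : {set T}) x y, x \in U -> y \in U -> x \in Q -> y \notin Q ->
    v \in bag x -> v \in bag y -> exists x' y',
    [/\ [/\ x' \in U, y' \in U, x' \in Q & y' \notin Q], e x' y', v \in bag x' & v \in bag y'];
  ctr_weight : forall t, t \in U -> 3 * #|W :&: acc t| <= #|W| }.

Lemma contracted_init : contracted setT (fun=> set0).
Proof.
case: tdec => -[_ e_sym _ _ _] vert edge conn; split.
- by move=> v; have [t vt] := vert v; exists t; rewrite ?inE // vt.
- by move=> s t v _ _; rewrite inE.
- by move=> t _; rewrite nbhd0 sub0set.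
- by move=> u v /edge[t [ut vt]]; exists t; rewrite ?inE // ut vt.
- move=> v Q x y _ _ xQ yQ vx vy; have /connectP[s] := conn v x y vx vy.
  elim: s x xQ vx => [|z s IHs] x xQ vx /=; first by move=> _ yx; rewrite yx xQ in yQ.
  case/andP=> /and3P[exz _ vz] pzs ys; case: (boolP (z \in Q)) => zQ.
    exact: (IHs z).
  by exists x, z; rewrite !inE.
- by move=> t _; rewrite setI0 cards0.
Qed.

(** The bound on [X] is [2 * w] because the separator may consist of two bags. *)
Definition separation (X Y : {set V}) :=
  [/\ #|X| <= 2 * w, [disjoint X & Y], nbhd g Y \subset Y :|: X,
      3 * #|W :&: Y| <= 2 * #|W| & 3 * #|W :\: (X :|: Y)| <= 2 * #|W|].

(** If the leaf has no neighbour left in [U], any other node serves as [p]; hence connectedness of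
    [U] need not be maintained during contraction. *)
Lemma remaining_leaf (U : {set T}) : 1 < #|U| ->
  exists t p, [/\ t \in U, p \in U :\ t & forall q, q \in U -> q != t -> e t q -> q = p].
Proof.
move=> U1; have [_ e_sym _ _ e_ac] := td_tree tdec.
have U0 : U != set0 by rewrite -card_gt0 ltnW.
have [t tU leaf] := acyclic_leaf e_sym e_ac U0.
case: (pickP [pred q | [&& q \in U, q != t & e t q]]) => [p|none].
  case/and3P=> pU pt etp; exists t, p; split; rewrite // ?inE ?pt //.
  by move=> q qU qt etq; apply: leaf.
have /set0Pn[p pU] : U :\ t != set0.
  by rewrite -card_gt0; move: U1; rewrite (cardsD1 t U) tU.
exists t, p; split=> // q qU qt etq.
by have /andP := none q; rewrite /= qU qt etq; case.
Qed.

(** A vertex of [bag t] outside [bag p] occurs in no other remaining bag, since the cut around [t]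
    can only be crossed towards [p]. It can therefore be absorbed into [p] along with [acc t]. *)
Lemma contract_leaf U acc t p : contracted U acc -> t \in U -> p \in U :\ t ->
    (forall q, q \in U -> q != t -> e t q -> q = p) ->
    3 * #|W :&: (acc p :|: acc t :|: (bag t :\: bag p))| <= #|W| ->
  contracted (U :\ t)
    (fun q => if q == p then acc p :|: acc t :|: (bag t :\: bag p) else acc q).
Proof.
move=> ctr tU /setD1P[pt pU] leaf weight.
have [_ e_sym _ _ _] := td_tree tdec.
case: ctr => cover acc_bag nbh edge cut wt.
have only v s : v \in bag t -> v \notin bag p -> s \in U -> v \in bag s -> s = t.
  move=> vt vp sU vs; apply: contraNeq vp => st.
  have [|x' [y' [[_ y'U /set1P-> y't] exy _ vy]]] := cut v [set t] t s tU sU (set11 t) _ vt vs.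
    by rewrite inE.
  by rewrite -(leaf y') // -in_set1.
have pU' : p \in U :\ t by rewrite !inE pt.
split.
- move=> v; have [s sU vs] := cover v; case: (eqVneq s t) => [st|st].
    exists p => //; rewrite eqxx !inE; move: vs; rewrite st inE.
    by case: (v \in bag p); case/orP=> ->; rewrite ?orbT.
  exists s; rewrite ?inE ?st //; case: eqP vs => [->|_]; rewrite !inE //.
  by case/orP=> ->; rewrite ?orbT.
- move=> s q v /setD1P[st sU] /setD1P[qt qU]; case: eqP => _; last exact: acc_bag.
  rewrite !inE => /orP[/orP[vp|vt]|/andP[vp vt]]; try exact: acc_bag (qU) _; eauto.
  by apply: contra qt => vq; apply/eqP; apply: only vt vp qU vq.
- move=> s /setD1P[st sU]; case: eqP => [->|_]; last exact: nbh.
  apply/subsetP=> u /nbhdP[|[v]]; first by move=> us; rewrite in_setU us.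
  have fin : [|| u \in acc p, u \in bag p, u \in acc t | u \in bag t] ->
      u \in acc p :|: acc t :|: (bag t :\: bag p) :|: bag p.
    by rewrite !inE; case: (u \in bag p); rewrite ?orbT //= orbF orbA => ->.
  move=> vI gvu; apply: fin; move: vI; rewrite !in_setU => /orP[/orP[vp|vt]|/setDP[vt vp]].
  + have := subsetP (nbh p pU) u (nbhd_edge vp gvu).
    by rewrite in_setU => /orP[->|->]; rewrite ?orbT.
  + have := subsetP (nbh t tU) u (nbhd_edge vt gvu).
    by rewrite in_setU => /orP[->|->]; rewrite ?orbT.
  + have [s' s'U /or3P[/andP[vs' us']|vs'|us']] := edge v u gvu.
    * by rewrite -(only v s' vt vp s'U vs') us' !orbT.
    * by rewrite (negPf (acc_bag s' t v s'U tU vs')) in vt.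
    * have := subsetP (nbh s' s'U) v; rewrite (nbhd_edge us') ?(g_sym u) // => /(_ isT).
      rewrite in_setU => /orP[vs'|vs'].
        by rewrite (negPf (acc_bag s' t v s'U tU vs')) in vt.
      by rewrite -(only v s' vt vp s'U vs') us' !orbT.
- move=> u v guv; have [s sU uv] := edge u v guv.
  case: (eqVneq s t) => [st|st]; last first.
    exists s; rewrite ?inE ?st //; case: eqP uv => [->|//]; rewrite !inE.
    by case/or3P=> ->; rewrite ?orbT.
  exists p => //; rewrite eqxx; move: uv; rewrite st => /or3P[/andP[ut vt]|ut|vt].
  + by rewrite !inE ut vt; case: (u \in bag p); case: (v \in bag p); rewrite ?orbT.
  + by rewrite !inE ut !orbT.
  + by rewrite !inE vt !orbT.
- move=> v Q x y /setD1P[xt xU] /setD1P[yt yU] xQ yQ vx vy.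
  (* Put [t] on the side of [p], so that no crossing edge is incident to it. *)
  pose Q' := [set q in U | if q == t then p \in Q else q \in Q].
  have [|| x' [y' [[x'U y'U]]]] := cut v Q' x y xU yU _ _ vx vy.
  + by rewrite inE (negPf xt) xU.
  + by rewrite inE (negPf yt) yU.
  rewrite !inE x'U y'U /=.
  case: (eqVneq x' t) => [->|x't]; case: (eqVneq y' t) => [->|y't].
  + by move=> ->.
  + by move=> pQ y'Q ety'; rewrite -(leaf y' y'U y't ety') (negPf y'Q) in pQ.
  + by move=> x'Q pQ; rewrite e_sym => etx'; rewrite -(leaf x' x'U x't etx') x'Q in pQ.
  by move=> x'Q y'Q exy vx' vy'; exists x', y'; rewrite !inE x't y't.
- by move=> s /setD1P[st sU]; case: eqP => _ //; apply: wt.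
Qed.

(** Leaves are contracted while the absorbed set has at most a third of [W]. At the first heavier
    one, the bags of [t] and [p] separate: [acc p] and [acc t] hold at most a third each, and less
    than two thirds lie outside the heavy set. If a single node is left, its bag separates. *)
Lemma contracted_separator U acc :
  contracted U acc -> U != set0 -> exists X Y, separation X Y.
Proof.
elim: {U}_.+1 {-2}U (ltnSn #|U|) acc => // k IHk U Uk acc ctr U0.
have [U1|U1] := leqP #|U| 1.
  have /cards1P[t defU] : #|U| == 1 by rewrite eqn_leq U1 card_gt0.
  have tU : t \in U by rewrite defU set11.
  exists (bag t), (acc t); split.
  - by apply: leq_trans (bag_w t) _; rewrite leq_pmull.
  - rewrite disjoint_sym disjoints_subset; apply/subsetP=> v vt; rewrite inE.
    exact: (ctr_acc_bag ctr tU tU vt).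
  - exact: (ctr_nbhd ctr tU).
  - by apply: leq_trans (ctr_weight ctr tU) _; rewrite leq_pmull.
  - rewrite (_ : _ :\: _ = set0) ?cards0 //; apply/eqP; rewrite setD_eq0.
    apply/subsetP=> v _; have [s] := ctr_cover ctr v.
    by rewrite defU => /set1P->.
have [t [p [tU pUt leaf]]] := remaining_leaf U1.
have [wle|wlt] := leqP (3 * #|W :&: (acc p :|: acc t :|: (bag t :\: bag p))|) #|W|.
  apply: IHk (contract_leaf ctr tU pUt leaf wle) _.
    by move: Uk; rewrite (cardsD1 t U) tU.
  by apply/set0Pn; exists p.
have /setD1P[pt pU] := pUt.
exists (bag p :|: bag t), (acc p :|: acc t); split.
- apply: leq_trans (leq_card_setU _ _) _.
  by rewrite mul2n -addnn leq_add.
- rewrite disjoint_sym disjoints_subset; apply/subsetP=> v; rewrite !inE => vpt.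
  by apply/norP; case/orP: vpt => vpt; split; apply: (ctr_acc_bag ctr) vpt.
- apply/subsetP=> u /nbhdP[|[v]]; rewrite !in_setU; first by move->.
  case/orP=> [vp|vt] gvu.
    have := subsetP (ctr_nbhd ctr pU) u (nbhd_edge vp gvu).
    by rewrite in_setU => /orP[->|->]; rewrite ?orbT.
  have := subsetP (ctr_nbhd ctr tU) u (nbhd_edge vt gvu).
  by rewrite in_setU => /orP[->|->]; rewrite ?orbT.
- rewrite setIUr; have := leq_of_leqif (leq_card_setU (W :&: acc p) (W :&: acc t)).
  have := ctr_weight ctr pU; have := ctr_weight ctr tU; lia.
- have : #|W :\: (bag p :|: bag t :|: (acc p :|: acc t))| <=
         #|W :\: (acc p :|: acc t :|: (bag t :\: bag p))|.
    apply/subset_leq_card/setDS/subsetP=> v; rewrite !inE.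
    by do 2!case: (v \in acc _); case: (v \in bag p); case: (v \in bag t).
  have := cardsID (acc p :|: acc t :|: (bag t :\: bag p)) W; lia.
Qed.

Lemma separator : exists X Y, separation X Y.
Proof.
apply: contracted_separator contracted_init _.
by have [T0 _ _ _ _] := td_tree tdec; rewrite -card_gt0 cardsT.
Qed.

End Separator.

(** * Nested dissection *)

Section Dissection.
Variables (V : finType) (g : rel V).

(* Binary nested dissection of height at most [h].  At a node [I] with
   children [Il] and [Ir], the vertices of [I :\: (Il :|: Ir)] separate the
   children from each other.  The lower bound on [#|I|] bounds the number of
   nodes of each level. *)
Inductive dissection (w : nat) : nat -> {set V} -> Prop :=
| Dissection0 h : dissection w h set0
| DissectionS h (I Il Ir : {set V}) of Il \subset I & Ir \subset I
    & [disjoint nbhd g Il & Ir] & [disjoint Il & nbhd g Ir]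
    & #|I :\: (Il :|: Ir)| <= 4 * w & #|bdry g I| <= 12 * w & w <= #|I|
    & dissection w h Il & dissection w h Ir : dissection w h.+1 I.

(** Symmetric form of [separation], so that both sides can be treated alike. *)
Definition sides (w : nat) (W X Y Z : {set V}) :=
  [/\ X :|: Y :|: Z = setT, #|X| <= 2 * w, [disjoint nbhd g Y & Z],
     [/\ [disjoint X & Y], nbhd g Y \subset Y :|: X & 3 * #|W :&: Y| <= 2 * #|W|]
   & [/\ [disjoint X & Z], nbhd g Z \subset Z :|: X & 3 * #|W :&: Z| <= 2 * #|W|]].

Hypothesis g_sym : symmetric g.

Lemma separation_sides w W X Y :
  separation g w W X Y -> sides w W X Y (~: (X :|: Y)).
Proof.
case=> Xw dXY nY WY WXY; have dYZ : [disjoint nbhd g Y & ~: (X :|: Y)].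
  by rewrite disjoints_subset setCK setUC.
split=> //; first by rewrite setUCr.
split; last by rewrite -setDE.
  by rewrite disjoints_subset setCK subsetUl.
have := disjoint_nbhd g_sym dYZ; rewrite disjoint_sym disjoints_subset => sub.
by apply: subset_trans sub _; apply/subsetP=> v; rewrite !inE; case: (v \in X); case: (v \in Y).
Qed.

(** A boundary vertex of [I :&: Y] lies in [X] or in [Y]; in the latter case it is outside [I],
    hence already a boundary vertex of [I]. *)
Lemma bdry_side w (I X Y : {set V}) : #|X| <= 2 * w -> nbhd g Y \subset Y :|: X ->
  #|bdry g (I :&: Y)| <= #|bdry g I :&: Y| + 2 * w.
Proof.
move=> Xw nY; apply: leq_trans (_ : #|(bdry g I :&: Y) :|: X| <= _); last first.
  by apply: leq_trans (leq_card_setU _ _) _; rewrite leq_add2l.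
apply/subset_leq_card/subsetP=> v /setDP[vn vIY].
have := subsetP nY v (subsetP (nbhdS g (subsetIr _ _)) v vn).
have := subsetP (nbhdS g (subsetIl _ _)) v vn.
rewrite in_setI in vIY; rewrite in_setU => vI; rewrite in_setU in_setI in_setD vI andbT.
by case/orP=> [vY|->]; rewrite ?orbT //; move: vIY; rewrite vY andbT => ->.
Qed.

(** A side with fewer than [w] vertices is merged into the separator, which thus has at most
    [2w + w + w = 4w] vertices. *)
Lemma dissection_split w W h (I X Y Z : {set V}) :
    w <= #|I| -> #|bdry g I| <= 12 * w -> sides w W X Y Z ->
    (w <= #|I :&: Y| -> dissection w h (I :&: Y)) ->
    (w <= #|I :&: Z| -> dissection w h (I :&: Z)) ->
  dissection w h.+1 I.
Proof.
move=> Iw bI [XYZ Xw dYZ _ _] disY disZ.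
pose keep (J : {set V}) := if w <= #|J| then J else set0.
have keepS (J : {set V}) : keep J \subset J by rewrite /keep; case: ifP; rewrite ?sub0set.
have keepD (J : {set V}) : #|J :\: keep J| <= w.
  rewrite /keep; case: (leqP w #|J|) => [_|/ltnW]; first by rewrite setDv cards0.
  by rewrite setD0.
have dis (J : {set V}) : (w <= #|J| -> dissection w h J) -> dissection w h (keep J).
  by rewrite /keep; case: ifP => [_|_ _]; [exact | exact: Dissection0].
have disj : [disjoint nbhd g (keep (I :&: Y)) & keep (I :&: Z)].
  apply: disjointWl (disjointWr _ dYZ).
    by apply/nbhdS/(subset_trans (keepS _))/subsetIr.
  exact/(subset_trans (keepS _))/subsetIr.
apply: (@DissectionS w h I (keep (I :&: Y)) (keep (I :&: Z))) => //.
- exact/(subset_trans (keepS _))/subsetIl.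
- exact/(subset_trans (keepS _))/subsetIl.
- exact: disjoint_nbhd.
- apply: (@leq_trans #|X :|: ((I :&: Y) :\: keep (I :&: Y)) :|: ((I :&: Z) :\: keep (I :&: Z))|).
    apply/subset_leq_card/subsetP=> v; have := in_setT v; rewrite -XYZ !inE.
    move=> + /andP[vk vI]; rewrite vI /=; case/norP: vk => -> ->.
    by case/orP=> [/orP[]|] ->; rewrite ?orbT.
  have := leq_of_leqif (leq_card_setU (X :|: ((I :&: Y) :\: keep (I :&: Y))) ((I :&: Z) :\: keep (I :&: Z))).
  have := leq_of_leqif (leq_card_setU X ((I :&: Y) :\: keep (I :&: Y))).
  have := keepD (I :&: Y); have := keepD (I :&: Z); lia.
- exact: dis.
- exact: dis.
Qed.

(** Each round takes two levels: balancing the boundary lowers its bound from [12w] to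
    [8w + 2w = 10w], and balancing the size then multiplies the size by at most 2/3 while the
    boundary grows back to at most [12w]. After [k] rounds at most [4w] vertices remain, which form
    a separator by themselves. *)
Lemma dissection_exists w k (I : {set V}) :
    (forall W, exists X Y, separation g w W X Y) ->
    #|bdry g I| <= 12 * w -> w <= #|I| -> 2 ^ k * #|I| <= 3 ^ k * (4 * w) ->
  dissection w (2 * k).+1 I.
Proof.
move=> sep; elim: k I => [|k IHk] I bI Iw.
  rewrite !mul1n => I4; apply: (@DissectionS w _ I set0 set0) => //; rewrite ?sub0set //.
  - by rewrite disjoint_sym disjoints_subset sub0set.
  - by rewrite disjoints_subset sub0set.
  - by rewrite setU0 setD0.
  - exact: Dissection0.
  - exact: Dissection0.
move=> Ik; rewrite mulnS.
(* Second split of the round, balancing the size. *)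
have half (J : {set V}) : J \subset I -> #|bdry g J| <= 10 * w -> w <= #|J| ->
    dissection w (2 * k).+2 J.
  move=> sJI bJ Jw; have JI := subset_leq_card sJI.
  have [X [Y sXY]] := sep J; move/separation_sides: sXY => sXY.
  have part (Z : {set V}) : 3 * #|J :&: Z| <= 2 * #|J| -> nbhd g Z \subset Z :|: X ->
      w <= #|J :&: Z| -> dissection w (2 * k).+1 (J :&: Z).
    move=> JZ nZ JZw; apply: IHk => //.
      case: sXY => _ Xw _ _ _; have := bdry_side J Xw nZ.
      have := subset_leq_card (subsetIl (bdry g J) Z); lia.
    move: Ik; rewrite !expnS; set p := 2 ^ k; set q := 3 ^ k; nia.
  apply: (dissection_split _ _ sXY) => //; first by lia.
    by case: sXY => _ _ _ [_ nY JY] _; apply: part.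
  by case: sXY => _ _ _ _ [_ nY JY]; apply: part.
(* First split of the round, balancing the boundary. *)
have [X [Y sXY]] := sep (bdry g I); move/separation_sides: sXY => sXY.
have part (Z : {set V}) : 3 * #|bdry g I :&: Z| <= 2 * #|bdry g I| -> nbhd g Z \subset Z :|: X ->
    w <= #|I :&: Z| -> dissection w (2 * k).+2 (I :&: Z).
  move=> IZ nZ IZw; apply: half => //; first exact: subsetIl.
  case: sXY => _ Xw _ _ _; have := bdry_side I Xw nZ; lia.
apply: (dissection_split _ _ sXY) => //.
  by case: sXY => _ _ _ [_ nY JY] _; apply: part.
by case: sXY => _ _ _ _ [_ nY JY]; apply: part.
Qed.

End Dissection.

(** * Vertex orderings for the strict complementary rank *)

Section Layout.
Variables (V : finType) (g : rel V).

(** Graph counterpart of the strict complementary rank: boundary sizes later bound the ranks of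
    blocks of the inverse. *)
Definition has_layout (B : nat) (J : {set V}) :=
  exists t : btree V, [/\ uniq (labels t), labels t =i J &
    forall s, s \in subtree_labels t -> #|bdry g [set i in s]| <= B].

Lemma has_layout0 B : has_layout B set0.
Proof. by exists BEmpty; split=> // i; rewrite inE. Qed.

Lemma has_layout_node B y (L R : {set V}) :
    has_layout B L -> has_layout B R -> [disjoint L & R] -> y \notin L :|: R ->
    #|bdry g (y |: (L :|: R))| <= B ->
  has_layout B (y |: (L :|: R)).
Proof.
case=> tl [ul ml bl] [tr [ur mr br]] dLR yLR bLR.
have mem_lr i : (i \in labels (BNode y tl tr)) = (i \in y |: (L :|: R)).
  by rewrite /= in_cons mem_cat ml mr !inE.
exists (BNode y tl tr); split=> //.
  rewrite /= mem_cat ml mr -in_setU yLR cat_uniq ul ur /= andbT.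
  apply/hasPn=> i; rewrite ml mr => iR; apply: contraL dLR => iL.
  by apply/pred0Pn; exists i; rewrite /= iL.
move=> s; rewrite in_cons mem_cat => /or3P[/eqP->|/bl|/br] //.
by rewrite (_ : [set i in _] = y |: (L :|: R)) //; apply/setP=> i; rewrite inE mem_lr.
Qed.

(** The vertex taken out of [L] becomes the root; an empty [L] needs none. *)
Lemma has_layout_join B (L R : {set V}) :
    (L != set0 -> exists2 y, y \in L & has_layout B (L :\ y)) -> has_layout B R ->
    [disjoint L & R] -> #|bdry g (L :|: R)| <= B ->
  has_layout B (L :|: R).
Proof.
move=> layL layR dLR bLR; have [->|/layL[y yL layLy]] := eqVneq L set0.
  by rewrite set0U.
rewrite -(setD1K yL) -setUA in bLR *.
apply: has_layout_node => //; first by apply: disjointWl dLR; apply: subsetDl.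
rewrite !inE eqxx /=; apply: contraL dLR => yR.
by apply/pred0Pn; exists y; rewrite /= yL.
Qed.

(** The vertices of [S :\: J] are stacked one by one as roots with a single child, which is why all
    intermediate sets need the bound. *)
Lemma has_layout_extend B (J S : {set V}) :
    has_layout B J -> J \subset S ->
    (forall S' : {set V}, J \subset S' -> S' \subset S -> #|bdry g S'| <= B) ->
  has_layout B S.
Proof.
move=> layJ; elim: {S}_.+1 {-2}S (ltnSn #|S|) => // k IHk S Sk sJS bd.
have [SJ|] := boolP (S \subset J).
  by rewrite (_ : S = J) //; apply/eqP; rewrite eqEsubset SJ.
case/subsetPn=> y yS yJ; rewrite -(setD1K yS) -(setU0 (S :\ y)).
have sJSy : J \subset S :\ y by rewrite subsetD1 sJS.
apply: has_layout_node; rewrite ?setU0 ?setD1K //.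
- apply: IHk => // [|S' sJS' sS'S].
    by move: Sk; rewrite (cardsD1 y S) yS.
  by apply: bd => //; apply: subset_trans sS'S (subsetDl _ _).
- exact: has_layout0.
- by rewrite disjoint_sym disjoints_subset sub0set.
- by rewrite !inE eqxx.
- exact: bd.
Qed.

(* A separator may be empty, so that a node with two children lacks a label of
   its own: it borrows one from its left subtree.  The induction therefore
   also provides layouts of [I] with one vertex missing. *)
Lemma dissection_layout w h (I S : {set V}) :
  dissection g w h I -> S \subset I -> #|I :\: S| <= 1 -> has_layout (16 * w).+1 S.
Proof.
move=> dis; elim: dis S => {h I} [h|h I Il Ir lI rI dlr dlr' sep bI Iw _ IHl _ IHr] S sSI IS.
  by move: sSI; rewrite subset0 => /eqP->; apply: has_layout0.
(* The bound adds [12w] for the boundary of [I], [4w] for the separator and one for the missing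
   vertex. *)
have bound (S' : {set V}) : S :&: (Il :|: Ir) \subset S' -> S' \subset S ->
    #|bdry g S'| <= (16 * w).+1.
  move=> sS' sS'S; apply: leq_trans (card_bdry_sub g (subset_trans sS'S sSI)) _.
  have : #|I :\: S'| <= #|(I :\: (Il :|: Ir)) :|: (I :\: S)|.
    apply/subset_leq_card/subsetP=> v /setDP[vI vS'].
    rewrite in_setU !in_setD vI !andbT -negb_and; apply: contra vS' => /andP[vlr vS].
    by apply: (subsetP sS'); rewrite in_setI vS.
  have := leq_of_leqif (leq_card_setU (I :\: (Il :|: Ir)) (I :\: S)); lia.
apply: (has_layout_extend _ (subsetIl S (Il :|: Ir)) bound).
have dLR : [disjoint S :&: Il & S :&: Ir].
  apply: disjointWl (disjointWr (subsetIr _ _) dlr).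
  exact: subset_trans (subsetIr _ _) (sub_nbhd _ _).
have bLR : #|bdry g (S :&: Il :|: S :&: Ir)| <= (16 * w).+1.
  by apply: bound; rewrite -setIUr ?subsetIl.
have near (J : {set V}) : J \subset I -> #|J :\: (S :&: J)| <= 1.
  move=> JI; apply: leq_trans IS; rewrite setDIr setDv setU0.
  exact/subset_leq_card/setSD.
have pop (J : {set V}) : J \subset I -> J \subset S ->
    (forall S' : {set V}, S' \subset J -> #|J :\: S'| <= 1 -> has_layout (16 * w).+1 S') ->
    S :&: J != set0 -> exists2 y, y \in S :&: J & has_layout (16 * w).+1 (S :&: J :\ y).
  move=> JI JS IHJ; rewrite (setIidPr JS) => /set0Pn[y yJ]; exists y => //.
  apply: IHJ; first exact: subsetDl.
  by rewrite setDDr setDv set0U; apply: leq_trans (subset_leq_card (subsetIr _ _)) _; rewrite cards1.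
(* As at most one vertex of [I] is missing, one of the children is complete and can lend a root
   label. *)
have [lS|/subsetPn[z zl zS]] := boolP (Il \subset S).
  rewrite setIUr; apply: has_layout_join => //; first exact: pop.
  by apply: IHr; rewrite ?subsetIr // near.
have rS : Ir \subset S.
  apply/subsetP=> v vr; apply: contraT => vS.
  have : [set z; v] \subset I :\: S.
    by rewrite subUset !sub1set !in_setD zS vS (subsetP lI) // (subsetP rI).
  move/subset_leq_card; rewrite cards2; case: eqVneq => [zv|_ /leq_trans/(_ IS)//].
  by case/pred0Pn: dlr; exists v; rewrite /= vr -zv (subsetP (sub_nbhd g Il)).
rewrite setIUr setUC; apply: has_layout_join; rewrite 1?disjoint_sym 1?setUC //; first exact: pop.
by apply: IHl; rewrite ?subsetIr // near.
Qed.

End Layout.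

(** * Ranks of off-diagonal blocks of the inverse *)

Local Open Scope ring_scope.

Section Rank.
Variables (F : fieldType) (n : nat).
Implicit Types (S C D : {set 'I_n}) (M : 'M[F]_n).

(** The coordinate projector onto [S]. Cutting out blocks by projectors keeps every matrix of size
    [n]. *)
Definition coordmx S : 'M[F]_n := diag_mx (\row_j (j \in S)%:R).

Lemma mul_coordmx S m (M : 'M[F]_(n, m)) :
  coordmx S *m M = \matrix_(i, j) ((i \in S)%:R * M i j).
Proof. by rewrite mul_diag_mx; apply/matrixP=> i j; rewrite !mxE. Qed.

Lemma mulmx_coord S m (M : 'M[F]_(m, n)) :
  M *m coordmx S = \matrix_(i, j) (M i j * (j \in S)%:R).
Proof. by rewrite mul_mx_diag; apply/matrixP=> i j; rewrite !mxE. Qed.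

Lemma coordmxI S C : coordmx S *m coordmx C = coordmx (S :&: C).
Proof.
by rewrite mulmx_diag; congr diag_mx; apply/rowP=> j; rewrite !mxE -natrM mulnb inE.
Qed.

Lemma coordmxC S : coordmx (~: S) = 1%:M - coordmx S.
Proof.
apply/matrixP=> i j; rewrite !mxE in_setC; case: (i == j); last by rewrite !mulr0n subr0.
by case: (i \in S); rewrite /= ?subrr ?subr0.
Qed.

Lemma coordmx_factor S :
  coordmx S = (rowsub (@enum_val _ (mem S)) 1%:M)^T *m rowsub (@enum_val _ (mem S)) 1%:M.
Proof.
apply/matrixP=> i j; rewrite !mxE; case: (boolP (j \in S)) => [jS|jS].
  rewrite (bigD1 (enum_rank_in jS j)) //= !mxE enum_rankK_in // eqxx mulr1 big1 ?addr0 => [|k kj].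
    by rewrite eq_sym; case: eqVneq => [<-|//]; rewrite jS.
  rewrite !mxE; case: (enum_val k =P j) => [kjE|_]; last by rewrite mulr0.
  by case/eqP: kj; apply: enum_val_inj; rewrite enum_rankK_in.
rewrite big1 => [|k _]; first by case: eqVneq => [->|//]; rewrite (negPf jS).
rewrite !mxE; case: (enum_val k =P j) => [kj|_]; last by rewrite mulr0.
by rewrite -kj enum_valP in jS.
Qed.

Lemma rank_coordmx S : \rank (coordmx S) = #|S|.
Proof.
apply/eqP; rewrite eqn_leq; apply/andP; split.
  by rewrite coordmx_factor; apply: leq_trans (mxrankM_maxl _ _) (rank_leq_col _).
pose s : 'M[F]_(#|S|, n) := rowsub (@enum_val _ (mem S)) 1%:M.
have ss1 : s *m s^T = 1%:M.
  apply/matrixP=> i j; rewrite !mxE (bigD1 (enum_val i)) //= !mxE eqxx mul1r.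
  rewrite (inj_eq enum_val_inj) eq_sym big1 ?addr0 // => k ki.
  by rewrite !mxE eq_sym (negPf ki) mul0r.
(* The identity of size [#|S|] is [(s s^T) (s s^T) = s (s^T s) s^T], with [coordmx S] as middle
   factor. *)
rewrite -{1}(mxrank1 F #|S|) -(mul1mx 1%:M) -{1}ss1 -ss1 mulmxA -(mulmxA s).
rewrite -coordmx_factor -mulmxA.
exact: leq_trans (mxrankM_maxr _ _) (mxrankM_maxl _ _).
Qed.

(** The rows in [D] are linearly independent vectors supported on [C]. *)
Lemma card_unitmx_rows M D C :
  M \in unitmx -> (forall i j, i \in D -> j \notin C -> M i j = 0) -> (#|D| <= #|C|)%N.
Proof.
move=> uM M0; rewrite -(rank_coordmx D) -(rank_coordmx C).
rewrite -(@mxrankMfree _ _ _ _ _ M) ?row_free_unit //.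
suff <-: coordmx D *m M *m coordmx C = coordmx D *m M by apply: mxrankM_maxr.
rewrite mulmx_coord mul_coordmx; apply/matrixP=> i j; rewrite !mxE.
case: (boolP (i \in D)) => iD; last by rewrite !mul0r.
by case: (boolP (j \in C)) => jC; rewrite ?mulr1 // M0 // !mulr0.
Qed.

Lemma kermx_idem_compl M : M *m M = M -> (kermx (1%:M - M) :=: M)%MS.
Proof.
move=> MM; apply/eqmxP/andP; split; last first.
  by apply/sub_kermxP; rewrite mulmxBr mulmx1 MM subrr.
have /sub_kermxP := submx_refl (kermx (1%:M - M)).
rewrite mulmxBr mulmx1 => /eqP; rewrite subr_eq0 => /eqP {1}->.
exact: submxMl.
Qed.

(* With [E] and [E'] idempotents of the same rank, the ranks of [E (1 - E')]
   and [E' (1 - E)] both equal this common rank minus that of the intersection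
   of the row spaces.  Here [E = A 1_S A^-1] and [E' = 1_S]. *)
Lemma rank_invmx_offdiag M S : M \in unitmx ->
  \rank (coordmx S *m invmx M *m coordmx (~: S)) = \rank (coordmx S *m M *m coordmx (~: S)).
Proof.
move=> uM; pose p := coordmx S; pose E := M *m p *m invmx M.
have pp : p *m p = p by rewrite coordmxI setIid.
have fM : row_full M by rewrite row_full_unit.
have EE : E *m E = E by rewrite /E !mulmxA mulmxKV // -(mulmxA M) pp.
have rE : \rank E = \rank p.
  by rewrite mxrankMfree ?row_free_unit ?unitmx_inv // (eqmxMfull _ fM).
have rk (X Y : 'M[F]_n) : Y *m Y = Y -> (\rank (X *m (1%:M - Y)) + \rank (X :&: Y)%MS)%N = \rank X.
  move=> YY; rewrite -(mxrank_mul_ker X (1%:M - Y)); congr (_ + _)%N.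
  by apply/eqmx_rank/eqmxP; apply: cap_eqmx => //; apply: eqmx_sym; apply: kermx_idem_compl.
have := rk E p pp; have := rk p E EE; rewrite rE capmxC => <- /addIn.
rewrite -coordmxC -/p => eqr.
(* Up to the invertible factor [M], on the left and on the right respectively, [E (1 - p)] is the
   block of the inverse and [p (1 - E)] the block of [M]. *)
transitivity (\rank (E *m coordmx (~: S))).
  by rewrite /E -!(mulmxA M) [RHS](eqmxMfull _ fM).
rewrite eqr -(@mxrankMfree _ _ _ _ _ M) ?row_free_unit //; congr (\rank _).
by rewrite coordmxC -/p -!mulmxA mulmxBl mul1mx /E mulmxKV // !mulmxBr mulmx1.
Qed.

Lemma rank_submx_of M S C : (\rank (submx_of M S C) <= \rank (coordmx S *m M *m coordmx C)%R)%N.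
Proof.
have -> : submx_of M S C = rowsub (@enum_val _ (mem S)) 1%:M *m (coordmx S *m M *m coordmx C) *m
    (rowsub (@enum_val _ (mem C)) 1%:M)^T.
  apply/matrixP=> i j; rewrite mul_rowsub_mx mul1mx trmx_mxsub trmx1 mulmx_colsub mulmx1.
  by rewrite mulmx_coord mul_coordmx !mxE !enum_valP mul1r mulr1.
exact: leq_trans (mxrankM_maxl _ _) (mxrankM_maxr _ _).
Qed.

(** The corresponding block of [M] is zero in all columns outside the boundary of [S]. *)
Lemma rank_submx_invmx (g : rel 'I_n) M S :
    M \in unitmx -> (forall i j, i != j -> M i j != 0 -> g i j) ->
  (\rank (submx_of (invmx M) S (~: S)) <= #|bdry g S|)%N.
Proof.
move=> uM Mg; apply: leq_trans (rank_submx_of _ _ _) _; rewrite rank_invmx_offdiag //.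
suff -> : coordmx S *m M *m coordmx (~: S) = coordmx S *m M *m coordmx (bdry g S).
  by rewrite -(rank_coordmx (bdry g S)) mxrankM_maxr.
rewrite !mulmx_coord mul_coordmx; apply/matrixP=> i j; rewrite !mxE in_setC in_setD.
case: (boolP (j \in S)) => //= jS; case: (boolP (i \in S)) => iS; last by rewrite !mul0r.
case: (boolP (j \in nbhd g S)) => // jn; rewrite mul1r; have [->|Mij] := eqVneq (M i j) 0.
  by rewrite !mul0r.
rewrite (nbhd_edge iS) // in jn; apply: Mg => //.
by apply: contraNneq jS => <-.
Qed.

End Rank.

(** * Elimination of one front *)

Section Pivoting.
Variables (F : fieldType) (n : nat).
Implicit Types (R C D S : {set 'I_n}) (M P Q N : 'M[F]_n).

(** Left multiplication by such a matrix changes only rows in [R], by combinations of rows in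
    [C]. *)
Definition near1 R C P :=
  forall i j, ~~ ((i \in R) && (j \in C)) -> P i j = (i == j)%:R.

Lemma near1_row R C P i j : near1 R C P -> i \notin R -> P i j = (i == j)%:R.
Proof. by move=> nP iR; apply: nP; rewrite (negPf iR). Qed.

Lemma near1_col R C P i j : near1 R C P -> j \notin C -> P i j = (i == j)%:R.
Proof. by move=> nP jC; apply: nP; rewrite (negPf jC) andbF. Qed.

Lemma near1S R R' C C' P : R \subset R' -> C \subset C' -> near1 R C P -> near1 R' C' P.
Proof.
move=> /subsetP sR /subsetP sC nP i j ij; apply: nP; apply: contra ij.
by case/andP=> /sR-> /sC->.
Qed.

Lemma near1_1 R C : near1 R C 1%:M.
Proof. by move=> i j _; rewrite mxE. Qed.

Lemma mulmx_unit_row P M i j : (forall k, P i k = (i == k)%:R) -> (P *m M) i j = M i j.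
Proof.
move=> Pi; rewrite mxE (bigD1 i) //= Pi eqxx mul1r big1 ?addr0 // => k ki.
by rewrite Pi eq_sym (negPf ki) mul0r.
Qed.

Lemma mulmx_unit_col P M i j : (forall k, M k j = (k == j)%:R) -> (P *m M) i j = P i j.
Proof.
move=> Mj; rewrite mxE (bigD1 j) //= Mj eqxx mulr1 big1 ?addr0 // => k kj.
by rewrite Mj (negPf kj) mulr0.
Qed.

Lemma near1M R C P Q : near1 R C P -> near1 R C Q -> near1 R C (P *m Q).
Proof.
move=> nP nQ i j; rewrite negb_and => /orP[iR|jC].
  by rewrite mulmx_unit_row => [|k]; [apply: near1_row nQ iR | apply: near1_row nP iR].
by rewrite mulmx_unit_col => [|k]; [apply: near1_col nP jC | apply: near1_col nQ jC].
Qed.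

(** [P - 1] is supported on columns in [C] and [Q - 1] on rows in [R'], so their product
    vanishes. *)
Lemma near1_mul_disjoint R C R' C' P Q :
    near1 R C P -> near1 R' C' Q -> [disjoint C & R'] ->
  P *m Q = P + Q - 1%:M.
Proof.
move=> nP nQ dCR; suff : (P - 1%:M) *m (Q - 1%:M) = 0.
  rewrite mulmxBl !mulmxBr !mulmx1 mul1mx => /eqP.
  by rewrite subr_eq0 subr_eq => /eqP->; rewrite addrC addrA.
apply/matrixP=> i j; rewrite !mxE big1 // => k _; rewrite !mxE.
have [kC|kC] := boolP (k \in C); last by rewrite (near1_col _ nP) // subrr mul0r.
by rewrite (near1_row _ nQ) ?subrr ?mulr0 //; apply: contraL dCR => kR; apply/pred0Pn; exists k; rewrite /= kC.
Qed.

Lemma near1_comm R C R' C' P Q :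
    near1 R C P -> near1 R' C' Q -> [disjoint C & R'] -> [disjoint R & C'] ->
  P *m Q = Q *m P.
Proof.
move=> nP nQ dCR dRC; rewrite (near1_mul_disjoint nP nQ) // (near1_mul_disjoint nQ nP).
  by rewrite (addrC P).
by rewrite disjoint_sym.
Qed.

(** This expresses that the index [i] is completely eliminated. *)
Definition unit_cross M i := forall j, M i j = (i == j)%:R /\ M j i = (i == j)%:R.

Lemma unit_cross_near1 R C P Q M i :
    near1 R C P -> near1 R C Q -> i \notin R -> i \notin C -> unit_cross M i ->
  unit_cross (P *m M *m Q^T) i.
Proof.
move=> nP nQ iR iC Mi j; split.
  rewrite -mulmxA mulmx_unit_row => [|k]; last exact: near1_row nP iR.
  rewrite mulmx_unit_row => [|k]; last by case: (Mi k).
  by rewrite mxE (near1_col _ nQ) // eq_sym.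
rewrite mulmx_unit_col => [|k]; last by rewrite mxE (near1_row _ nQ) // eq_sym.
rewrite mulmx_unit_col => [|k]; last by case: (Mi k) => _ ->; rewrite eq_sym.
by rewrite (near1_col _ nP) // eq_sym.
Qed.

Implicit Types u v : 'cV[F]_n.

(** Simultaneous row operations with source row [b]; the entry [u b 0] also rescales that row, by
    [1 + u b 0]. *)
Definition rowop (u : 'cV[F]_n) b : 'M[F]_n := 1%:M + u *m delta_mx 0 b.

Lemma mul_rowop u b M i j : (rowop u b *m M) i j = M i j + u i 0 * M b j.
Proof. by rewrite mulmxDl mul1mx -mulmxA -rowE !mxE big_ord1 !mxE. Qed.

Lemma rowopE u b i j : rowop u b i j = (i == j)%:R + u i 0 * (b == j)%:R.
Proof. by rewrite -[rowop u b]mulmx1 mul_rowop !mxE. Qed.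

Lemma mul_rowop_tr u b M i j : (M *m (rowop u b)^T) i j = M i j + M i b * u j 0.
Proof.
rewrite -[M]trmxK -trmx_mul [LHS]mxE mul_rowop ![M^T^T _ _]mxE; congr (_ + _).
exact: mulrC.
Qed.

Lemma near1_rowop R C u b :
  (forall i, i \notin R -> u i 0 = 0) -> b \in C -> near1 R C (rowop u b).
Proof.
move=> uR bC i j; rewrite rowopE negb_and.
case/orP=> [iR|jC]; first by rewrite uR // mul0r addr0.
case: (eqVneq b j) jC => [<-|_ _]; first by rewrite bC.
by rewrite mulr0 addr0.
Qed.

(** The inverse is the Sherman-Morrison formula for a rank-one update. *)
Lemma rowop_unit u b : 1 + u b 0 != 0 -> rowop u b \in unitmx.
Proof.
move=> ub; have /mulmx1_unit[] // : rowop u b *m rowop (- (1 + u b 0)^-1 *: u) b = 1%:M.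
apply/matrixP=> i j; rewrite mul_rowop !rowopE !mxE.
case: (eqVneq b j) => [<-|_]; last by rewrite !mulr0 !addr0 mulr0 addr0.
by rewrite /= !mulr1; field.
Qed.

Definition front_supp S C M :=
  forall i j, i \in S -> j \notin S :|: C -> M i j = 0 /\ M j i = 0.

Lemma pivot_one S C M b : front_supp S C M -> b \in S -> M b b != 0 ->
  exists P Q, [/\ near1 (S :|: C) S P /\ near1 (S :|: C) S Q, P \in unitmx /\ Q \in unitmx,
    unit_cross (P *m M *m Q^T) b & front_supp (S :\ b) C (P *m M *m Q^T)].
Proof.
move=> sM bS Mb.
(* [u] scales the pivot to 1 and clears its column; [v] then clears its row, needing no further
   scaling. What remains is the Schur complement. *)
pose u : 'cV[F]_n := \col_i (if i == b then (M b b)^-1 - 1 else - (M i b / M b b)).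
pose v : 'cV[F]_n := \col_j (if j == b then 0 else - (M b j / M b b)).
have sSC i : i \notin S :|: C -> i != b.
  by apply: contraNneq => ->; rewrite in_setU bS.
have entry i j : (rowop u b *m M *m (rowop v b)^T) i j =
    if (i == b) || (j == b) then (i == j)%:R else M i j - M i b * M b j / M b b.
  rewrite mul_rowop_tr !mul_rowop !mxE.
  have -> : M i b + (if i == b then (M b b)^-1 - 1 else - (M i b / M b b)) * M b b = (i == b)%:R.
    case: eqVneq => [->|_]; first by rewrite mulrBl mulVf // mul1r addrC subrK.
    by rewrite mulNr divfK // subrr.
  case: (eqVneq i b) => [->|ib] /=.
    rewrite mulrBl mul1r addrCA subrr addr0 mul1r; case: (eqVneq j b) => [->|jb].
      by rewrite ?eqxx addr0 mulVf.
    by rewrite mulrC subrr.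
  rewrite mul0r addr0; case: (eqVneq j b) => [->|jb].
    by rewrite (negPf ib) mulNr divfK // subrr.
  by rewrite mulNr mulrAC.
exists (rowop u b), (rowop v b); split.
- split; apply: near1_rowop => // i iSC; rewrite mxE (negPf (sSC i iSC)).
    by have [_ ->] := sM b i bS iSC; rewrite mul0r oppr0.
  by have [-> _] := sM b i bS iSC; rewrite mul0r oppr0.
- split; apply: rowop_unit; rewrite mxE eqxx ?addr0 ?oner_neq0 //.
  by rewrite addrC subrK invr_neq0.
- by move=> j; rewrite !entry eqxx /= orbT eq_sym.
move=> i j /setD1P[ib iS] jSC; rewrite !entry (negPf ib) /= orbF.
have [jb|jb] := eqVneq j b; first by rewrite jb (negPf ib) eq_sym (negPf ib).
have {}jSC : j \notin S :|: C by move: jSC; rewrite !inE (negPf jb).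
have [-> ->] := sM i j iS jSC; have [-> ->] := sM b j bS jSC.
by rewrite !(mul0r, mulr0) subrr.
Qed.

(** Pivots are eliminated until the block on the remaining indices [D] is zero; rows and columns in
    [D] are then supported on [C]. *)
Lemma pivot_block S C M : [disjoint S & C] -> front_supp S C M ->
  exists P Q D, let M' := P *m M *m Q^T in
  [/\ near1 (S :|: C) S P /\ near1 (S :|: C) S Q, P \in unitmx /\ Q \in unitmx, D \subset S,
    forall i, i \in S :\: D -> unit_cross M' i &
    forall i j, i \in D -> j \notin C -> M' i j = 0 /\ M' j i = 0].
Proof.
elim: {S}_.+1 {-2}S (ltnSn #|S|) M => // k IHk S Sk M dSC sM.
case: (pickP [pred ab | [&& ab.1 \in S, ab.2 \in S & M ab.1 ab.2 != 0]]); last first.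
  move=> none; exists 1%:M, 1%:M, S; rewrite trmx1 mul1mx mulmx1; split=> //; rewrite ?unitmx1 //.
  - by split; apply: near1_1.
  - by move=> i; rewrite setDv inE.
  move=> i j iS jC; have [jS|jS] := boolP (j \in S); last first.
    by apply: sM; rewrite // in_setU negb_or jS.
  have /negbT := none (i, j); rewrite /= iS jS negbK => /eqP->.
  by have /negbT := none (j, i); rewrite /= iS jS negbK => /eqP->.
case=> a b /= /and3P[aS bS Mab].
(* If the diagonal entry at [b] is zero, adding row [a] to row [b] turns it into [M a b], which is
   nonzero. *)
have [P0 [nP0 uP0 sM0 Mb]] : exists P, [/\ near1 (S :|: C) S P, P \in unitmx,
    front_supp S C (P *m M) & (P *m M) b b != 0].
  have [Mb|Mb] := eqVneq (M b b) 0; last first.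
    by exists 1%:M; rewrite mul1mx; split=> //; [apply: near1_1 | apply: unitmx1].
  have ab : a != b by apply: contraNneq Mab => ->; rewrite Mb.
  exists (rowop (delta_mx b 0) a); split.
  - apply: near1_rowop => // i iSC; rewrite mxE andbT; case: eqVneq iSC => // ->.
    by rewrite in_setU bS.
  - by apply: rowop_unit; rewrite mxE (negPf ab) addr0 oner_neq0.
  - move=> i j iS jSC; rewrite !mul_rowop; have [-> ->] := sM i j iS jSC.
    have [-> _] := sM a j aS jSC; rewrite !mxE !andbT mulr0 addr0; split=> //.
    case: eqVneq jSC => [->|_ _]; first by rewrite in_setU bS.
    by rewrite mul0r addr0.
  - by rewrite mul_rowop Mb add0r !mxE !eqxx mul1r.
have [P1 [Q1 [[nP1 nQ1] [uP1 uQ1] Mb1 sM1]]] := pivot_one sM0 bS Mb.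
have dSbC : [disjoint S :\ b & C] by apply: disjointWl dSC; apply: subsetDl.
have [|P2 [Q2 [D]]] := IHk (S :\ b) _ _ dSbC sM1.
  by move: Sk; rewrite (cardsD1 b S) bS.
case=> -[nP2 nQ2] [uP2 uQ2] sD cross zero.
have bC : b \notin C.
  by apply: contraL dSC => bC; apply/pred0Pn; exists b; rewrite /= bS.
have eqM : P2 *m P1 *m P0 *m M *m (Q2 *m Q1)^T =
    P2 *m (P1 *m (P0 *m M) *m Q1^T) *m Q2^T.
  by rewrite trmx_mul !mulmxA.
have wide P : near1 (S :\ b :|: C) (S :\ b) P -> near1 (S :|: C) S P.
  by apply: near1S; rewrite ?setSU // subsetDl.
exists (P2 *m P1 *m P0), (Q2 *m Q1), D; rewrite /= eqM; split.
- by split; do ?apply: near1M => //; apply: wide.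
- by rewrite !unitmx_mul uP2 uP1 uP0 uQ2.
- exact: subset_trans sD (subsetDl _ _).
- move=> i /setDP[iS iD]; have [->|ib] := eqVneq i b; last first.
    by apply: cross; rewrite !inE ib iS iD.
  by apply: unit_cross_near1 nP2 nQ2 _ _ Mb1; rewrite !inE eqxx.
- exact: zero.
Qed.

End Pivoting.

(** * Elimination along a dissection *)

Lemma prod_mulmx_cat (F : fieldType) n (T : Type) (f : T -> 'M[F]_n) (s t : seq T) :
  \big[mulmx/1%:M]_(x <- s ++ t) f x =
  \big[mulmx/1%:M]_(x <- s) f x *m \big[mulmx/1%:M]_(x <- t) f x.
Proof.
by elim: s => [|x s IHs]; rewrite ?cat0s ?cat_cons ?big_nil ?mul1mx // !big_cons IHs mulmxA.
Qed.

Section Elimination.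
Variables (F : fieldType) (n : nat) (g : rel 'I_n) (w : nat).
Implicit Types (I J D : {set 'I_n}) (B P Q : 'M[F]_n).

Local Notation block := ({set 'I_n} * {set 'I_n} * 'M[F]_n)%type.

(* A layer is a product of blocks (rows, columns, matrix) eliminated in
   parallel; by the disjointness condition it equals the identity plus the sum
   of their off-identity parts. *)
Definition layer I B := exists s : seq block,
  [/\ forall b, b \in s -> [/\ near1 b.1.1 b.1.2 b.2, b.1.1 \subset nbhd g I, b.1.2 \subset I,
        (#|b.1.1| <= 40 * w)%N & (#|b.1.2| <= 40 * w)%N],
      pairwise (fun b c : block => [disjoint b.1.2 & c.1.1]) s,
      (size s * w <= #|I|)%N & B = \big[mulmx/1%:M]_(b <- s) b.2].

(** The leftmost layer, that of the level nearest the root, is applied last. *)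
Fixpoint layers h I P : Prop :=
  if h is h'.+1 then exists B P', [/\ layer I B, layers h' I P' & P = B *m P'] else P = 1%:M.

Lemma layer_near1 I B : layer I B -> near1 (nbhd g I) I B.
Proof.
case=> s [sI _ _ ->]; elim: s sI => [|b s IHs] sI; rewrite ?big_nil ?big_cons; first exact: near1_1.
have [nb bR bC _ _] := sI b (mem_head b s).
by apply: near1M (near1S bR bC nb) (IHs _) => c cs; apply: sI; rewrite inE cs orbT.
Qed.

Lemma layers_near1 h I P : layers h I P -> near1 (nbhd g I) I P.
Proof.
elim: h P => [|h IHh] P /= => [->|[B [P' [/layer_near1 nB /IHh nP' ->]]]]; first exact: near1_1.
exact: near1M.
Qed.

(** Empty layers pad the branches that end early. *)
Lemma layers1 h I : layers h I 1%:M.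
Proof.
elim: h => // h IHh; exists 1%:M, 1%:M; rewrite mulmx1; split=> //.
by exists [::]; rewrite big_nil.
Qed.

Section Parallel.
Variables (I Il Ir : {set 'I_n}).
Hypotheses (sl : Il \subset I) (sr : Ir \subset I).
Hypotheses (dlr : [disjoint nbhd g Il & Ir]) (drl : [disjoint Il & nbhd g Ir]).

Lemma layer_parallel B B' : layer Il B -> layer Ir B' -> layer I (B *m B').
Proof.
case=> s [sI ps sw ->] [s' [sI' ps' sw' ->]]; exists (s ++ s'); split; last by rewrite prod_mulmx_cat.
- move=> b; rewrite mem_cat => /orP[/sI|/sI'] [nb bR bC rb cb]; split=> //.
  + exact: subset_trans bR (nbhdS g sl).
  + exact: subset_trans bC sl.
  + exact: subset_trans bR (nbhdS g sr).
  + exact: subset_trans bC sr.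
- rewrite pairwise_cat ps ps' !andbT; apply/allrelP=> b c /sI[_ _ bC _ _] /sI'[_ cR _ _ _].
  exact: disjointWl bC (disjointWr cR drl).
- rewrite size_cat mulnDl; apply: leq_trans (leq_add sw sw') _.
  rewrite -cardsUI (_ : Il :&: Ir = set0) ?cards0 ?addn0 ?subset_leq_card ?subUset ?sl //.
  by apply/eqP; rewrite setI_eq0; apply: disjointWl dlr; apply: sub_nbhd.
Qed.

Lemma layers_comm h h' P P' : layers h Il P -> layers h' Ir P' -> P *m P' = P' *m P.
Proof. by move=> /layers_near1 nP /layers_near1 nP'; apply: near1_comm nP nP' _ _. Qed.

(** Operations in the two children commute, so equal levels can be brought together. *)
Lemma layers_parallel h P P' : layers h Il P -> layers h Ir P' -> layers h I (P *m P').
Proof.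
elim: h P P' => [|h IHh] P P' /=; first by move=> -> ->; rewrite mulmx1.
case=> B [Q [lB lQ ->]] [B' [Q' [lB' lQ' ->]]]; exists (B *m B'), (Q *m Q'); split.
- exact: layer_parallel.
- exact: IHh.
rewrite !mulmxA; congr (_ *m _); rewrite -!mulmxA; congr (_ *m _).
by apply: near1_comm (layers_near1 lQ) (layer_near1 lB') _ _.
Qed.

End Parallel.

Variable A : 'M[F]_n.
Hypotheses (g_sym : symmetric g) (A_unit : A \in unitmx).
Hypothesis A_g : forall i j, i != j -> A i j != 0 -> g i j.

Lemma outside_nbhd I i j : i \in I -> j \notin nbhd g I -> A i j = 0 /\ A j i = 0.
Proof.
move=> iI jI; have ij : i != j.
  by apply: contraNneq jI => <-; apply: (subsetP (sub_nbhd g I)).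
have gij : ~~ g i j by apply: contra jI; apply: nbhd_edge.
split; apply: contraNeq gij; first exact: A_g.
by rewrite g_sym => /A_g; apply; rewrite eq_sym.
Qed.

(** Fill-in stays inside the neighbourhood: operations on [I] only combine rows and columns of [I],
    all of which vanish at [j]. *)
Lemma transformed_outside_nbhd I P Q i j :
    near1 (nbhd g I) I P -> near1 (nbhd g I) I Q -> i \in I -> j \notin nbhd g I ->
  (P *m A *m Q^T) i j = 0 /\ (P *m A *m Q^T) j i = 0.
Proof.
move=> nP nQ iI jI; split.
  rewrite mulmx_unit_col => [|k]; last by rewrite mxE (near1_row _ nQ jI) eq_sym.
  rewrite mxE big1 // => k _; have [kI|kI] := boolP (k \in I).
    by case: (outside_nbhd kI jI) => ->; rewrite mulr0.
  by rewrite (near1_col _ nP kI); case: eqP kI => [<-|]; rewrite ?iI ?mul0r.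
rewrite -mulmxA mulmx_unit_row => [|k]; last exact: near1_row nP jI.
rewrite mxE big1 // => k _; have [kI|kI] := boolP (k \in I).
  by case: (outside_nbhd kI jI) => _ ->; rewrite mul0r.
by rewrite mxE (near1_col _ nQ kI); case: eqP kI => [<-|]; rewrite ?iI ?mulr0.
Qed.

Lemma dissection_bdry h I : dissection g w h I -> (#|bdry g I| <= 12 * w)%N.
Proof. by case=> // h'; rewrite bdry0 cards0. Qed.

(* The indices in [D] are those whose pivot is delayed to the parent.  After
   elimination their rows vanish outside the boundary of [I], so that
   invertibility of [A] bounds their number. *)
Lemma dissection_elimination h I : dissection g w h I ->
  exists P Q D, [/\ layers h I P /\ layers h I Q, P \in unitmx /\ Q \in unitmx, D \subset I,
    (#|D| <= #|bdry g I|)%N & forall i, i \in I :\: D -> unit_cross (P *m A *m Q^T) i].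
Proof.
elim=> {h I} [h|h I Il Ir sl sr dlr drl sep bI Iw disl IHl disr IHr].
  exists 1%:M, 1%:M, set0; split; rewrite ?unitmx1 ?sub0set ?cards0 //; first by split; apply: layers1.
  by move=> i; rewrite setDv inE.
have [Pl [Ql [Dl [[lPl lQl] [uPl uQl] sDl cDl crl]]]] := IHl.
have [Pr [Qr [Dr [[lPr lQr] [uPr uQr] sDr cDr crr]]]] := IHr.
pose P0 := Pl *m Pr; pose Q0 := Ql *m Qr; pose A0 := P0 *m A *m Q0^T.
have lP0 : layers h I P0 by apply: layers_parallel lPl lPr.
have lQ0 : layers h I Q0 by apply: layers_parallel lQl lQr.
(* The pivots of this front: the separator and the pivots delayed by the children. *)
pose S := (I :\: (Il :|: Ir)) :|: (Dl :|: Dr); pose C := bdry g I.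
have sSI : S \subset I.
  by rewrite !subUset subsetDl (subset_trans sDl) ?(subset_trans sDr).
(* An index finished in one child lies outside the neighbourhood of the other, whose operations
   leave its cross intact. *)
have done_cross i : i \in I :\: S -> unit_cross A0 i.
  case/setDP=> iI; rewrite !in_setU in_setD iI andbT negb_or negbK negb_or in_setU.
  case/andP=> /orP[il|ir] /andP[iDl iDr].
    have -> : A0 = Pr *m (Pl *m A *m Ql^T) *m Qr^T.
      rewrite /A0 /P0 /Q0 (layers_comm dlr drl lPl lPr) (layers_comm dlr drl lQl lQr).
      by rewrite trmx_mul !mulmxA.
    have iN : i \notin nbhd g Ir.
      by apply: contraL drl => iN; apply/pred0Pn; exists i; rewrite /= il.
    apply: (unit_cross_near1 (layers_near1 lPr) (layers_near1 lQr) iN).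
      by apply: contra iN; apply/subsetP/sub_nbhd.
    by apply: crl; rewrite in_setD iDl.
  have -> : A0 = Pl *m (Pr *m A *m Qr^T) *m Ql^T by rewrite /A0 trmx_mul !mulmxA.
  have iN : i \notin nbhd g Il.
    by apply: contraL dlr => iN; apply/pred0Pn; exists i; rewrite /= iN.
  apply: (unit_cross_near1 (layers_near1 lPl) (layers_near1 lQl) iN).
    by apply: contra iN; apply/subsetP/sub_nbhd.
  by apply: crr; rewrite in_setD iDr.
have dSC : [disjoint S & C].
  by apply: disjointWl sSI _; rewrite disjoint_sym disjoints_subset /C /bdry setDE subsetIr.
have supp : front_supp S C A0.
  move=> i j iS; rewrite in_setU negb_or => /andP[jS jC].
  have iI := subsetP sSI i iS; have [jI|jI] := boolP (j \in I).
    have ji : j != i by apply: contraNneq jS => ->.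
    have [-> ->] := done_cross j (introT setDP (conj jI jS)) i.
    by rewrite (negPf ji).
  apply: transformed_outside_nbhd (layers_near1 lP0) (layers_near1 lQ0) iI _.
  by apply: contra jC => jn; rewrite in_setD jI.
have [P1 [Q1 [D []]]] := pivot_block dSC supp.
have eqA : P1 *m A0 *m Q1^T = (P1 *m P0) *m A *m (Q1 *m Q0)^T.
  by rewrite /A0 [(Q1 *m Q0)^T]trmx_mul !mulmxA.
rewrite eqA => -[nP1 nQ1] [uP1 uQ1] sDS cross zero.
(* [4w] for the separator and [12w] for the delayed pivots of each child; the boundary brings the
   front to [40w]. *)
have cS : (#|S| <= 28 * w)%N.
  rewrite -[28%N]/(4 + (12 + 12))%N !mulnDl (leq_trans (leq_card_setU _ _)) // leq_add //.
  rewrite (leq_trans (leq_card_setU _ _)) // leq_add //.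
    exact: leq_trans cDl (dissection_bdry disl).
  exact: leq_trans cDr (dissection_bdry disr).
have cSC : (#|S :|: C| <= 40 * w)%N.
  by rewrite -[40%N]/(28 + 12)%N mulnDl (leq_trans (leq_card_setU _ _)) // leq_add.
have new_layer B : near1 (S :|: C) S B -> layer I B.
  move=> nB; exists [:: (S :|: C, S, B)]; split; rewrite ?big_cons ?big_nil ?mulmx1 ?mul1n //.
  move=> b; rewrite inE => /eqP-> /=; split=> //.
    by rewrite subUset (subset_trans sSI (sub_nbhd g I)) subsetDl.
  by rewrite (leq_trans cS) // leq_mul2r orbT.
exists (P1 *m P0), (Q1 *m Q0), D; split.
- by split; [exists P1, P0 | exists Q1, Q0]; split=> //; apply: new_layer.
- by rewrite !unitmx_mul uP1 uQ1 uPl uPr uQl uQr.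
- exact: subset_trans sDS sSI.
- apply: (@card_unitmx_rows _ _ (P1 *m P0 *m A *m (Q1 *m Q0)^T)).
    by rewrite !unitmx_mul unitmx_tr !unitmx_mul uP1 uQ1 uPl uPr uQl uQr A_unit.
  by move=> i j iD jC; case: (zero i j iD jC).
move=> i /setDP[iI iD]; have [iS|iS] := boolP (i \in S).
  by apply: cross; rewrite in_setD iS iD.
rewrite -eqA; apply: (unit_cross_near1 nP1 nQ1 _ iS).
  by rewrite in_setU negb_or iS /= in_setD iI.
by apply: done_cross; rewrite in_setD iS iI.
Qed.

Lemma dissection_invmx h : dissection g w h setT ->
  exists P Q, [/\ layers h setT P, layers h setT Q & invmx A = Q^T *m P].
Proof.
move/dissection_elimination=> [P [Q [D [[lP lQ] [uP uQ] _ cD cross]]]].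
exists P, Q; split=> //.
have D0 : D = set0.
  by move: cD; rewrite /bdry setDT cards0 leqn0 cards_eq0 => /eqP.
have PAQ : P *m A *m Q^T = 1%:M.
  apply/matrixP=> i j; have iD : i \in setT :\: D by rewrite D0 setD0 inE.
  by rewrite [RHS]mxE; case: (cross i iD j).
have {}PAQ : Q^T *m P *m A = 1%:M by rewrite -mulmxA; apply: mulmx1C.
by rewrite -[LHS]mul1mx -PAQ mulmxK.
Qed.

End Elimination.

(** * Butterfly factors *)

Section Butterfly.
Variables (F : fieldType) (n : nat).
Local Notation block := ({set 'I_n} * {set 'I_n} * 'M[F]_n)%type.

(** Butterfly blocks must have exactly [r] rows and columns, so smaller index sets are filled up
    arbitrarily. *)
Definition pad_set r (S : {set 'I_n}) : {set 'I_n} :=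
  S :|: [set x in take (r - #|S|)%N (enum (~: S))].

Lemma card_pad_set r (S : {set 'I_n}) : (#|S| <= r)%N -> (r <= n)%N -> #|pad_set r S| = r.
Proof.
move=> Sr rn; rewrite /pad_set; set t := take _ _.
have ut : uniq t by apply/take_uniq/enum_uniq.
have St : [disjoint S & [set x in t]].
  rewrite disjoint_sym disjoints_subset; apply/subsetP=> x; rewrite inE => /mem_take.
  by rewrite mem_enum.
have [_] := leq_card_setU S [set x in t]; rewrite St => /eqP ->.
rewrite cardsE (card_uniqP ut) size_take_min -cardE (minn_idPl _) ?subnKC //.
by rewrite [#|~: S|]cardsCs setCK card_ord leq_sub2r.
Qed.

(** Disjointness makes all cross terms vanish. The row support of the product is carried along so
    that [near1_mul_disjoint] applies at each step. *)
Lemma prod_blocks_offdiag (s : seq block) :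
    (forall b, b \in s -> near1 b.1.1 b.1.2 b.2) ->
    pairwise (fun b c : block => [disjoint b.1.2 & c.1.1]) s ->
  let B := \big[mulmx/1%:M]_(b <- s) b.2 in
  near1 [set i | has (fun b : block => i \in b.1.1) s] setT B /\
  forall i j, i != j -> B i j != 0 -> exists2 b, b \in s & (i \in b.1.1) && (j \in b.1.2).
Proof.
elim: s => [|b s IHs] ns ps /=.
  rewrite big_nil; split; first exact: near1_1.
  by move=> i j /negPf ij; rewrite mxE ij eqxx.
move: ps; rewrite pairwise_cons => /andP[/allP ps /IHs[c cs|nB offB]].
  by apply: ns; rewrite inE cs orbT.
have nb := ns b (mem_head b s); rewrite big_cons; split.
  apply: near1M; first by apply: near1S nb => //; apply/subsetP=> i ib; rewrite inE ib.
  by apply: near1S nB => //; apply/subsetP=> i; rewrite !inE => ->; rewrite orbT.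
move=> i j ij; rewrite (near1_mul_disjoint nb nB); last first.
  rewrite disjoint_sym disjoints_subset; apply/subsetP=> k; rewrite !inE => /hasP[c cs kc].
  by apply: contraL (ps c cs) => kb; apply/pred0Pn; exists k; rewrite /= kb.
rewrite !mxE (negPf ij) subr0; have [bij|bij _] := eqVneq (b.2 i j) 0.
  rewrite bij add0r => /(offB i j ij)[c cs ijc]; exists c => //.
  by rewrite inE cs orbT.
exists b; rewrite ?mem_head //; apply: contraNT bij => ijb.
by rewrite (nb i j ijb) (negPf ij).
Qed.

Lemma butterfly_factor_tr r (B : 'M[F]_n) : butterfly_factor r B -> butterfly_factor r B^T.
Proof.
case=> bl [sz cb off]; exists [seq (b.2, b.1) | b <- bl]; rewrite size_map; split=> //.
  by move=> _ /mapP[b /cb[b1 b2] ->].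
move=> i j; rewrite mxE => /off[->|[b bb ijb]]; [by left | right].
by exists (b.2, b.1); rewrite ?(map_f (fun b => (b.2, b.1))) //= andbC.
Qed.

Lemma butterfly_factor_full (B : 'M[F]_n) : (0 < n)%N -> butterfly_factor n B.
Proof.
move=> n0; exists [:: (setT, setT)]; split.
- by rewrite /ceil_div divnn n0.
- by move=> b; rewrite inE => /eqP->; rewrite cardsT card_ord.
by move=> i j _; right; exists (setT, setT); rewrite !inE.
Qed.

(** The list is cut into [m] consecutive chunks, each short enough for one factor. *)
Lemma prod_blocks_chunks r m (s : seq block) :
    (r <= n)%N ->
    (forall b, b \in s -> [/\ near1 b.1.1 b.1.2 b.2, (#|b.1.1| <= r)%N & (#|b.1.2| <= r)%N]) ->
    pairwise (fun b c : block => [disjoint b.1.2 & c.1.1]) s ->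
    (size s <= m * ceil_div n r)%N ->
  exists Bs : seq 'M[F]_n, [/\ size Bs = m, forall B, B \in Bs -> butterfly_factor r B &
    \big[mulmx/1%:M]_(b <- s) b.2 = \big[mulmx/1%:M]_(B <- Bs) B].
Proof.
move=> rn; elim: m s => [|m IHm] s sr ps.
  by rewrite mul0n leqn0 size_eq0 => /eqP->; exists [::]; rewrite !big_nil.
set c := ceil_div n r => sm.
move: ps; rewrite -{1}(cat_take_drop c s) pairwise_cat => /and3P[_ pt pd].
have [b /mem_drop/sr//||Bs [szB BsF eqBs]] := IHm (drop c s) _ pd.
  by rewrite size_drop leq_subLR -mulSn.
exists (\big[mulmx/1%:M]_(b <- take c s) b.2 :: Bs); split.
- by rewrite /= szB.
- move=> B; rewrite inE => /orP[/eqP->|/BsF//].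
  have tr b : b \in take c s -> near1 b.1.1 b.1.2 b.2 by case/mem_take/sr.
  have [_ off] := prod_blocks_offdiag tr pt.
  exists [seq (pad_set r b.1.1, pad_set r b.1.2) | b <- take c s]; split.
  + by rewrite size_map size_take_min geq_minl.
  + by move=> _ /mapP[b /mem_take/sr[_ b1 b2] ->]; rewrite !card_pad_set.
  move=> i j Bij; have [->|ij] := eqVneq i j; [by left | right].
  have [b bs /andP[ib jb]] := off i j ij Bij.
  exists (pad_set r b.1.1, pad_set r b.1.2); last by rewrite !in_setU ib jb.
  by apply/mapP; exists b.
by rewrite big_cons -eqBs -prod_mulmx_cat cat_take_drop.
Qed.

Lemma leq_mul_ceil_div r : (0 < r)%N -> (n <= ceil_div n r * r)%N.
Proof.
move=> r0; rewrite /ceil_div mulnDl; case: (boolP (r %| n)%N) => [/divnK->|_].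
  exact: leq_addr.
by rewrite mul1n {1}(divn_eq n r) leq_add2l ltnW // ltn_mod.
Qed.

Lemma layers_factorization (g : rel 'I_n) w h P : (0 < w)%N -> (40 * w <= n)%N ->
    layers g w h setT P ->
  exists Bs : seq 'M[F]_n, [/\ size Bs = (h * 40)%N,
    forall B, B \in Bs -> butterfly_factor (40 * w) B & P = \big[mulmx/1%:M]_(B <- Bs) B].
Proof.
move=> w0 wn; elim: h P => [|h IHh] P /=; first by move=> ->; exists [::]; rewrite big_nil.
case=> B [P' [[s [sI ps sw ->]] /IHh[Bs [szB BsF ->]] ->]].
have sr b : b \in s -> [/\ near1 b.1.1 b.1.2 b.2, (#|b.1.1| <= 40 * w)%N & (#|b.1.2| <= 40 * w)%N].
  by case/sI.
(* A layer has at most [n / w] blocks and one factor holds about [n / (40 w)] of them, so 40 factors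
   suffice. *)
have sz : (size s <= 40 * ceil_div n (40 * w))%N.
  rewrite -(leq_pmul2r w0) (leq_trans sw) // cardsT card_ord mulnC mulnA [(w * 40)%N]mulnC mulnC.
  by apply: leq_mul_ceil_div; rewrite muln_gt0.
have [Cs [szC CsF ->]] := prod_blocks_chunks wn sr ps sz.
exists (Cs ++ Bs); rewrite size_cat szB szC mulSn prod_mulmx_cat; split=> // C.
by rewrite mem_cat => /orP[/CsF|/BsF].
Qed.

Lemma trmx_prod (Bs : seq 'M[F]_n) :
  (\big[mulmx/1%:M]_(B <- Bs) B)^T = \big[mulmx/1%:M]_(B <- rev [seq B^T | B <- Bs]) B.
Proof.
elim: Bs => [|B Bs IHBs]; first by rewrite !big_nil trmx1.
by rewrite big_cons trmx_mul IHBs /= rev_cons -cats1 prod_mulmx_cat big_cons big_nil mulmx1.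
Qed.

Lemma has_layout_strict_rank (g : rel 'I_n) (A : 'M[F]_n) m r :
    A \in unitmx -> (forall i j, i != j -> A i j != 0 -> g i j) ->
    has_layout g m setT -> (m <= r)%N ->
  strict_complementary_rank (invmx A) r.
Proof.
move=> uA Ag [t [ut mt bt]] mr; exists t; split=> [|s /bt bs].
  by apply: uniq_perm ut (enum_uniq _) _ => i; rewrite mt mem_enum inE.
exact: leq_trans (rank_submx_invmx _ uA Ag) (leq_trans bs mr).
Qed.

Lemma has_layout_trivial (g : rel 'I_n) : has_layout g n setT.
Proof.
apply: (has_layout_extend (has_layout0 g n) (sub0set _)) => S' _ _.
by rewrite -{6}(card_ord n) max_card.
Qed.

Lemma conjtrmx_invmx (inv : {rmorphism F -> F}) (A : 'M[F]_n) :
  A \in unitmx -> conjtrmx inv A = A -> conjtrmx inv (invmx A) = invmx A.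
Proof.
have conjE B : conjtrmx inv B = map_mx inv B^T by apply/matrixP=> i j; rewrite !mxE.
by move=> uA; rewrite !conjE trmx_inv map_invmx => ->.
Qed.

End Butterfly.

(** * From treewidth to the butterfly factorization *)

Lemma mx_graph_sym (F : fieldType) (inv : {rmorphism F -> F}) n (A : 'M[F]_n) :
  conjtrmx inv A = A -> symmetric (mx_graph A).
Proof.
move=> AH i j; rewrite /mx_graph eq_sym; congr (_ && _).
by rewrite -{1}AH mxE fmorph_eq0.
Qed.

(** A positive width excludes the truncated predecessor, so some bag has [tau + 1] vertices. *)
Lemma treewidth_lt_card (V : finType) (g : rel V) tau :
  has_treewidth g tau -> (0 < tau)%N -> (tau < #|V|)%N.
Proof.
case=> -[T [e [bag [_ <-]]]] _; rewrite /td_width => tau0.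
have : (\max_(t : T) #|bag t| <= #|V|)%N by apply/bigmax_leqP=> t _; apply: max_card.
by case: (\max_(t : T) _) tau0.
Qed.

Lemma treewidth_dissection (V : finType) (g : rel V) tau :
    symmetric g -> has_treewidth g tau -> (0 < tau)%N ->
  dissection g tau.+1 (4 * trunc_log 2 #|V| + 5) setT.
Proof.
move=> gs tw tau0; have ltV := treewidth_lt_card tw tau0.
case: tw => -[T [e [bag [tdec tdw]]]] _; set L := trunc_log 2 #|V|.
have bag_w t : (#|bag t| <= tau.+1)%N.
  rewrite -tdw /td_width; apply: leq_trans (leqSpred _).
  exact: (leq_bigmax (F := fun t => #|bag t|)).
have -> : (4 * L + 5 = (2 * (2 * L.+1)).+1)%N by lia.
apply: dissection_exists => //.
- by move=> W; apply: separator gs tdec bag_w W.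
- by rewrite /bdry setDT cards0.
- by rewrite cardsT.
(* With [k = 2 (L + 1)] rounds and [#|V| < 2 ^ (L + 1)], the size condition follows from
   [4 * 2 <= 9]. *)
rewrite cardsT !expnM.
have /ltnW/(leq_mul (leqnn ((2 ^ 2) ^ L.+1)%N)) : (#|V| < 2 ^ L.+1)%N by apply: trunc_log_ltn.
rewrite -expnMn => /leq_trans; apply; apply: (@leq_trans ((3 ^ 2) ^ L.+1)%N).
  by rewrite leq_exp2r.
by rewrite leq_pmulr.
Qed.

Theorem theorem6p4 :
  exists c_rank c_len : nat,
    forall (F : fieldType) (inv : {rmorphism F -> F}) (n : nat)
           (A : 'M[F]_n) (tau : nat),
      involutive inv ->
      A \in unitmx ->
      conjtrmx inv A = A ->
      has_treewidth (mx_graph A) tau ->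
      (1 <= tau)%N ->
      exists (r : nat) (Bs : seq 'M[F]_n),
        (r <= c_rank * tau)%N /\
        butterfly_decomposition c_len inv (invmx A) r Bs.
Proof.
(* [40 (tau + 1) <= 80 tau], and the two products have [2 * 40 * (4 L + 5) <= 720 L] factors, as
   [L >= 1]. *)
exists 80%N, 720%N => F inv n A tau _ uA AH tw tau0.
have gs := mx_graph_sym AH; have dis := treewidth_dissection gs tw tau0.
have ltn := treewidth_lt_card tw tau0; rewrite card_ord in dis ltn.
have Ag i j : i != j -> A i j != 0 -> mx_graph A i j by rewrite /mx_graph => -> ->.
have KH := conjtrmx_invmx uA AH.
have L0 : (0 < trunc_log 2 n)%N by rewrite trunc_log_gt0 /=; lia.
(* Blocks of size [40 (tau + 1)] do not fit if [n] is smaller; then [n] itself is O(tau) and the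
   inverse is a single full block. *)
have [rn|rn] := leqP (40 * tau.+1) n; last first.
  exists n, [:: invmx A]; split; first by lia.
  split; rewrite ?big_cons ?big_nil ?mulmx1 //=; last 2 first.
  - by lia.
  - by move=> B; rewrite inE => /eqP->; apply: butterfly_factor_full; lia.
  split=> //; first by lia.
  exact: has_layout_strict_rank uA Ag (has_layout_trivial _) _.
exists (40 * tau.+1)%N.
have [P [Q [lP lQ eqK]]] := dissection_invmx gs uA Ag dis.
have [Ps [szP PsF eqP]] := layers_factorization (ltn0Sn tau) rn lP.
have [Qs [szQ QsF eqQ]] := layers_factorization (ltn0Sn tau) rn lQ.
exists (rev [seq B^T | B <- Qs] ++ Ps); split; first by lia.
split.
- split=> //.
  have lay : has_layout (mx_graph A) (16 * tau.+1).+1 setT.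
    by apply: dissection_layout dis (subxx _) _; rewrite setDv cards0.
  by apply: has_layout_strict_rank uA Ag lay _; lia.
- by rewrite size_cat size_rev size_map szP szQ; lia.
- move=> B; rewrite mem_cat mem_rev => /orP[/mapP[B' /QsF BF ->]|/PsF//].
  exact: butterfly_factor_tr.
by rewrite prod_mulmx_cat -trmx_prod -eqP -eqQ.
Qed.
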